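(* For every theory $\mathsf T$ in the language $\mathcal L_\Box$, we have $\mathsf{GL}\neq\mathsf{PL}(\mathsf T)$.
   Context: $\mathsf{GL}$ is $\mathsf K$ plus $\Box A\to\Box\Box A$ and $\Box(\Box A\to A)\to\Box A$, in the language $\mathcal L_\Box$ (atomic propositions, $\bot$, $\to$, unary $\Box$), identified with its set of theorems. A theory $\mathsf T$ is a pair of a set of axioms and a set of inference rules; $\mathsf T\vdash A$ means derivability. A phrase is a formula $\bigwedge X\to\bigvee Y$ where $X,Y$ are finite disjoint sets of formulas each of which is an atom or of the form $\Box B$ (with a fixed ordering of conjuncts/disjuncts, $\bigwedge\emptyset=\top$, $\bigvee\emptyset=\bot$). Each formula $A$ is assigned its conjunctive normal form, a finite set $Z_A$ of phrases with $A$ classically equivalent to $\bigwedge Z_A$. For a phrase $\bigwedge X\to\bigvee Y$, its $\mathsf T$-interpretation is the metastatement ''if $\mathsf T\vdash E$ for every $\Box E\in X$, then $\mathsf T\vdash F$ for some $\Box F\in Y$''. For a formula $A$, $A^{\mathsf T}$ is the conjunction of the $\mathsf T$-interpretations of the phrases in $Z_A$. $\mathsf{PL}(\mathsf T)$ is the set of all $A\in\mathcal L_\Box$ such that $A^{\mathsf T}$ is true. *)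

(* Defs.v *)
From HB Require Import structures.
From mathcomp Require Import all_boot finmap boolp classical_sets.

Set Implicit Arguments.
Unset Strict Implicit.
Unset Printing Implicit Defensive.

Local Open Scope fset_scope.

Inductive form : Type :=
| Atom of nat
| Bot
| Imp of form & form
| Box of form.

Fixpoint form_encode (A : form) : GenTree.tree nat :=
  match A with
  | Atom n => GenTree.Leaf n
  | Bot => GenTree.Node 0 [::]
  | Imp B C => GenTree.Node 1 [:: form_encode B; form_encode C]
  | Box B => GenTree.Node 2 [:: form_encode B]
  end.

Fixpoint form_decode (t : GenTree.tree nat) : option form :=
  match t with
  | GenTree.Leaf n => Some (Atom n)
  | GenTree.Node 0 [::] => Some Bot
  | GenTree.Node 1 [:: t1; t2] =>
      match form_decode t1, form_decode t2 with
      | Some B, Some C => Some (Imp B C)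
      | _, _ => None
      end
  | GenTree.Node 2 [:: t1] => omap Box (form_decode t1)
  | _ => None
  end.

Lemma form_encodeK : pcancel form_encode form_decode.
Proof. by elim=> [n||B IHB C IHC|B IHB] //=; rewrite ?IHB ?IHC. Qed.

HB.instance Definition _ := Countable.copy form (pcan_type form_encodeK).

Definition Top : form := Imp Bot Bot.
Definition Neg (A : form) : form := Imp A Bot.
Definition And (A B : form) : form := Neg (Imp A (Neg B)).
Definition Or (A B : form) : form := Imp (Neg A) B.

Definition bigAnd (s : seq form) : form := foldr And Top s.
Definition bigOr (s : seq form) : form := foldr Or Bot s.

Definition atom_or_box (A : form) : bool :=
  match A with Atom _ | Box _ => true | _ => false end.

(* Boxed formulas are treated as propositional variables: only the values of
   [v] on atoms and on formulas [Box B] are ever consulted. *)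
Fixpoint eval (v : form -> bool) (A : form) : bool :=
  match A with
  | Atom _ | Box _ => v A
  | Bot => false
  | Imp B C => eval v B ==> eval v C
  end.

Definition tautology (A : form) : Prop := forall v, eval v A.

Definition classically_equivalent (A B : form) : Prop :=
  tautology (And (Imp A B) (Imp B A)).

(* A rule is the set of its instances (premises, conclusion). *)
Definition rule : Type := set (seq form * form).

Record theory : Type := Theory { axioms : set form; rules : set rule }.

Inductive derivable (T : theory) : form -> Prop :=
| derivable_axiom A : axioms T A -> derivable T A
| derivable_rule (r : rule) (premises : seq form) (A : form) :
    rules T r -> r (premises, A) ->
    (forall B, B \in premises -> derivable T B) -> derivable T A.

Inductive GL_axiom : form -> Prop :=
| GL_taut A : tautology A -> GL_axiom A
| GL_K A B : GL_axiom (Imp (Box (Imp A B)) (Imp (Box A) (Box B)))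
| GL_4 A : GL_axiom (Imp (Box A) (Box (Box A)))
| GL_Lob A : GL_axiom (Imp (Box (Imp (Box A) A)) (Box A)).

Definition modus_ponens : rule :=
  [set i | exists A B, i = ([:: Imp A B; A], B)]%classic.

Definition necessitation : rule :=
  [set i | exists A, i = ([:: A], Box A)]%classic.

Definition GL_theory : theory :=
  Theory GL_axiom [set modus_ponens; necessitation]%classic.

Definition GL : set form := [set A | derivable GL_theory A]%classic.

Definition is_phrase (XY : {fset form} * {fset form}) : bool :=
  [&& all atom_or_box XY.1, all atom_or_box XY.2 & fdisjoint XY.1 XY.2].

(* A phrase is kept as the pair (X, Y), from which its formula
   /\X -> \/Y is computed; the order of the conjuncts and of the disjuncts is
   the canonical enumeration of [{fset form}]. *)
Record phrase : Type := Phrase {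
  phrase_pair : {fset form} * {fset form};
  phraseP : is_phrase phrase_pair }.

HB.instance Definition _ := [isSub for phrase_pair].
HB.instance Definition _ := [Countable of phrase by <:].

Definition lhs (P : phrase) : {fset form} := (phrase_pair P).1.
Definition rhs (P : phrase) : {fset form} := (phrase_pair P).2.

Definition phrase_form (P : phrase) : form :=
  Imp (bigAnd (enum_fset (lhs P))) (bigOr (enum_fset (rhs P))).

Definition cnf_assignment (Z : form -> {fset phrase}) : Prop :=
  forall A, classically_equivalent A
              (bigAnd [seq phrase_form P | P <- enum_fset (Z A)]).

Definition phrase_interp (T : theory) (P : phrase) : Prop :=
  (forall E, Box E \in lhs P -> derivable T E) ->
  exists F, Box F \in rhs P /\ derivable T F.

Definition interp (Z : form -> {fset phrase}) (T : theory) (A : form) : Prop :=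
  forall P, P \in Z A -> phrase_interp T P.

Definition PL (Z : form -> {fset phrase}) (T : theory) : set form :=
  [set A | interp Z T A]%classic.

Lemma eval_bigAnd v s : eval v (bigAnd s) = all (eval v) s.
Proof. by elim: s => //= A s ->; case: (eval v A); case: all. Qed.

Lemma eval_bigOr v s : eval v (bigOr s) = has (eval v) s.
Proof. by elim: s => //= A s ->; case: (eval v A); case: has. Qed.

Lemma classically_equivalentP A B :
  classically_equivalent A B <-> forall v, eval v A = eval v B.
Proof.
by split=> h v; have /= := h v; [|move->]; case: (eval v A); case: (eval v B).
Qed.

Fixpoint base (A : form) : {fset form} :=
  match A with
  | Atom _ | Box _ => [fset A]
  | Bot => fset0
  | Imp B C => base B `|` base C
  end.

Lemma base_atom_or_box A B : B \in base A -> atom_or_box B.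
Proof.
elim: A => [n||C IHC D IHD|C IHC] /=; rewrite ?inE //; try by move/eqP->.
by case/orP; [apply: IHC|apply: IHD].
Qed.

Lemma eq_eval_base A v w : {in base A, v =1 w} -> eval v A = eval w A.
Proof.
elim: A => [n||C IHC D IHD|C IHC] //= h; try by apply: h; rewrite inE.
by rewrite IHC ?IHD // => B BB; apply: h; rewrite inE BB ?orbT.
Qed.

(* The phrases excluding exactly the valuations of [base A] that falsify A. *)
Definition full_cnf (A : form) : {fset phrase} :=
  [fset P in pmap insub
     [seq (X, base A `\` X) | X <- [seq X <- enum_fset (fpowerset (base A))
                                   | ~~ eval (fun B => B \in X) A]]].

Lemma full_cnfP A P :
  reflect (exists2 X, X `<=` base A /\ ~~ eval (fun B => B \in X) A
                    & phrase_pair P = (X, base A `\` X))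
          (P \in full_cnf A).
Proof.
rewrite /full_cnf inE /= mem_pmap; apply: (iffP mapP) => [[XY]|[X [XA nA] PE]].
- case/mapP=> X; rewrite mem_filter fpowersetE => /andP[nA XA] -> PE.
  by exists X => //; case: insubP PE => //= Q _ QE [->].
- exists (X, base A `\` X); last by rewrite -PE valK.
  by apply/mapP; exists X; rewrite // mem_filter nA fpowersetE.
Qed.

Lemma full_cnf_assignment : cnf_assignment full_cnf.
Proof.
move=> A; apply/classically_equivalentP => v.
have evE B : B \in base A -> eval v B = v B.
  by move/base_atom_or_box; case: B.
rewrite eval_bigAnd all_map; apply/idP/allP => [vA P PA|h].
- have [X [XA nA] PE] := full_cnfP _ _ PA.
  rewrite /= eval_bigAnd eval_bigOr /lhs /rhs PE /=.
  apply/implyP => /allP vX; apply: contraNT nA => /hasPn vY.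
  rewrite -(@eq_eval_base A v) // => B BA.
  have [BX|BX] := boolP (B \in X); first by rewrite -evE ?vX.
  by apply: negbTE; rewrite -evE // vY // inE BX.
- apply: contraT => nA.
  pose X := [fset B in base A | v B].
  have XA : X `<=` base A by apply/fsubsetP => B; rewrite !inE => /andP[].
  have YP : is_phrase (X, base A `\` X).
    apply/and3P; split=> /=.
    - by apply/allP => B /(fsubsetP XA)/base_atom_or_box.
    - by apply/allP => B; rewrite inE => /andP[_ /base_atom_or_box].
    - by apply/fdisjointP => B BX; rewrite inE BX.
  have /h : Phrase YP \in full_cnf A.
    apply/full_cnfP; exists X => //; split=> //.
    by rewrite (@eq_eval_base A _ v) // => B BA; rewrite !inE BA.
  rewrite /= eval_bigAnd eval_bigOr /lhs /rhs /= => /implyP/(_ _)/hasP[].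
    by apply/allP => B; rewrite !inE => /andP[BA]; rewrite evE.
  by move=> B; rewrite !inE => /andP[+ BA]; rewrite BA /= evE // => /negbTE->.
Qed.

(* Main.v *)
Require Import Defs.
From mathcomp Require Import all_boot finmap boolp classical_sets.

(** Since the two sides of a phrase are disjoint, the atoms of a phrase can be
    falsified freely, so a formula lies in PL(T) as soon as it is true under
    every valuation that reads [Box E] as "T proves E". Hence PL(T) decides
    [Box Bot]: it contains [Box Bot] or [Neg (Box Bot)], according to whether T
    is inconsistent. GL contains neither: the second fails at a dead end, the
    first at a point whose only successor is a dead end. *)

(** Truth at a world without successors: boxes hold vacuously, and atoms are set to false. *)
Definition dead_end (A : form) : bool :=
  if A is Box _ then true else false.

Definition above_dead_end (A : form) : bool :=
  if A is Box B then eval dead_end B else false.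

(** The two worlds go together: necessitation at the upper one needs its premise at the lower
    one. *)
Lemma GL_sound A : GL A -> eval dead_end A /\ eval above_dead_end A.
Proof.
elim=> {A} [_ [A tA|A B|A|A]|r s A rT rs _ IH] //=.
- by split=> //; apply/implyP => /implyP AB; apply/implyP.
- by rewrite implybT.
(* [Box A] holds at the dead end, so the Löb antecedent reduces to [A] there. *)
- by rewrite implybb.
- case: rT rs => -> [B] => [[C]|] [sE AE]; subst.
    have [] := IH (Imp B C); first by rewrite inE eqxx.
    have [] := IH B; first by rewrite !inE eqxx orbT.
    by move=> /= -> ->.
  by have [] := IH B; first by rewrite inE.
Qed.

Lemma interp_of_eval Z T A : cnf_assignment Z ->
  (forall v, (forall E, v (Box E) = `[< derivable T E >]) -> eval v A) ->
  interp Z T A.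
Proof.
move=> hZ hA P PA lhsT.
(* Only atoms on the left are true; by disjointness a true disjunct on the right must be a box. *)
pose v B := if B is Box E then `[< derivable T E >] else B \in lhs P.
have /and3P[/allP Xab /allP Yab /fdisjointP XY] := phraseP P.
have vX B : B \in lhs P -> eval v B.
  move=> BX; case: B BX (Xab _ BX) => //= E EX _.
  by apply/asboolP/lhsT.
have := hA v (fun=> erefl).
have /classically_equivalentP -> := hZ A; rewrite eval_bigAnd all_map.
move=> /allP/(_ _ PA) /=; rewrite eval_bigAnd eval_bigOr.
move=> /implyP/(_ (introT allP vX))/hasP[B BY vB].
case: B BY vB (Yab _ BY) => //= [n nY nX|F FY /asboolP TF] _; last by exists F.
by have := XY _ nX; rewrite nY.
Qed.

Theorem theoremA3 (Z : form -> {fset phrase}) (hZ : cnf_assignment Z)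
  (T : theory) : GL <> PL Z T.
Proof.
move=> GL_PL; have [TBot|nTBot] := pselect (derivable T Bot).
- have : GL (Box Bot).
    rewrite GL_PL; apply: interp_of_eval => // v vT /=.
    by rewrite vT; apply/asboolP.
  by case/GL_sound.
- have : GL (Neg (Box Bot)).
    rewrite GL_PL; apply: interp_of_eval => // v vT /=.
    by rewrite vT implybF; apply/asboolPn.
  by case/GL_sound.
Qed.
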